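(* Every nontrivial, connected graph $G$ with at least one unlooped vertex has a representation $G\cong G_1\mathbin{\square}\cdots\mathbin{\square}G_k$ as a product of irreducible graphs with respect to the Cartesian product. The representation is unique up to isomorphisms and the order of the factors; that is, if also $G\cong H_1\mathbin{\square}\cdots\mathbin{\square}H_\ell$ with all $H_j$ irreducible, then $k=\ell$ and there is a permutation $\pi$ of $\{1,\ldots,k\}$ with $G_i\cong H_{\pi(i)}$ for every $i\in\{1,\ldots,k\}$.
   Context: A graph $G=(V(G),E(G))$ is a finite undirected graph without multiple edges, in which loops are allowed: $E(G)\subseteq V(G)\times V(G)$ is a symmetric set of ordered pairs, and a loop on $v$ is the edge $(v,v)\in E(G)$. A vertex is unlooped if it has no loop. An isomorphism of graphs is a bijection $\varphi$ of vertex sets with $(v,w)$ an edge if and only if $(\varphi(v),\varphi(w))$ is an edge (loops included). The Cartesian product $G_1\mathbin{\square}\cdots\mathbin{\square}G_k$ of graphs has vertex set $V(G_1)\times\cdots\times V(G_k)$, and two (possibly equal) vertices $(v_1,\ldots,v_k)$ and $(w_1,\ldots,w_k)$ are adjacent if there is an index $i$ such that $(v_i,w_i)\in E(G_i)$ and $v_j=w_j$ for all $j\neq i$. In particular, $(v_1,\ldots,v_k)$ has a loop if and only if at least one $v_i$ has a loop in $G_i$. A graph is trivial if it consists of a single vertex without edges (so without a loop); otherwise it is nontrivial. A nontrivial, connected graph $G$ with at least one unlooped vertex is called irreducible (with respect to the Cartesian product) if for every factorization $G=H\mathbin{\square}L$ (up to isomorphism), either $H$ or $L$ is trivial. *)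

(* Defs.v *)
From mathcomp Require Import all_boot all_fingroup.

Set Implicit Arguments.
Unset Strict Implicit.
Unset Printing Implicit Defensive.

(* Loops are allowed: [edge] is symmetric but not assumed irreflexive. *)
Record graph : Type := Graph {
  vertex :> finType;
  edge : rel vertex;
  edge_sym : symmetric edge
}.
Arguments edge {g} _ _.

Definition isomorphic (G H : graph) : Prop :=
  exists f : G -> H,
    bijective f /\ forall v w : G, edge v w <-> edge (f v) (f w).

Definition unlooped (G : graph) (v : G) : bool := ~~ edge v v.

Definition connected (G : graph) : Prop :=
  forall v w : G, connect (@edge G) v w.

Definition trivial (G : graph) : Prop :=
  #|G| = 1 /\ forall v w : G, ~~ edge v w.

Definition nontrivial (G : graph) : Prop := ~ trivial G.

Section CartesianProduct.

Variables (k : nat) (G : 'I_k -> graph).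

(* For k = 0 this is the trivial graph. *)
Definition cartprod_edge : rel {dffun forall i : 'I_k, G i} :=
  fun v w =>
    [exists i, edge (v i) (w i) && [forall j, (j != i) ==> (v j == w j)]].

Lemma cartprod_edge_sym : symmetric cartprod_edge.
Proof.
move=> v w; apply: eq_existsb => i; rewrite edge_sym; congr (_ && _).
by apply: eq_forallb => j; rewrite [v j == _]eq_sym.
Qed.

Definition cartprod : graph := Graph cartprod_edge_sym.

End CartesianProduct.

Section BinaryCartesianProduct.

Variables H L : graph.

Definition cartprod2_edge : rel (H * L)%type :=
  fun v w => (edge v.1 w.1 && (v.2 == w.2)) || (edge v.2 w.2 && (v.1 == w.1)).

Lemma cartprod2_edge_sym : symmetric cartprod2_edge.
Proof.
move=> v w; rewrite /cartprod2_edge [edge v.1 _]edge_sym [edge v.2 _]edge_sym.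
by rewrite [v.1 == _]eq_sym [v.2 == _]eq_sym.
Qed.

Definition cartprod2 : graph := Graph cartprod2_edge_sym.

End BinaryCartesianProduct.

Definition irreducible (G : graph) : Prop :=
  [/\ nontrivial G, connected G, (exists v : G, unlooped v) &
      forall H L : graph,
        isomorphic G (cartprod2 H L) -> trivial H \/ trivial L].

(* Main.v *)
Require Import Defs.
From mathcomp Require Import all_boot all_fingroup.
From Stdlib Require Import Classical.

(** Existence is a descent on the number of vertices. A nontrivial graph with
    an unlooped vertex has at least two vertices, so when G is a product of
    two nontrivial graphs H and L, both are smaller; they are connected and
    have an unlooped vertex, because they are projections of G.

    Uniqueness rests on geodesic convexity: a set is convex when it contains
    every vertex lying on a shortest walk between two of its members. The
    notion is visibly preserved by isomorphisms, and in a product it sees the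
    factors, because a walk splits into a walk of the i-th coordinate and a walk
    of the remaining ones whose lengths add up ([walk_split]). Hence
    - every layer, that is every copy of a factor through a vertex a, is convex
      ([convex_layer]);
    - a convex set is closed under replacing one coordinate of a member by that
      of another member ([convex_upd]), so that it is a box.

    Loops matter when these sets are read as graphs: if a is unlooped, the
    subgraph induced on the i-th layer through a is the i-th factor itself,
    since no loop can come from the constant coordinates. For the same reason a
    convex set S through an unlooped b induces the product of its part in the
    layer of b and its part with i-th coordinate equal to that of b
    ([induced_convex_split]). If S is irreducible, one of the two parts is a
    single vertex for every i, which forces S into one layer of b
    ([irreducible_convex]).

    Let f be an isomorphism between two products of irreducible graphs, and let
    a be unlooped. Then f maps every layer through a into a layer through f a,
    and so does its inverse in the other direction; layers of nontrivial factors
    are not nested in one another, so f maps layers onto layers. This gives an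
    injection from the factors of one product to isomorphic factors of the other
    ([factors_match]); using it both ways shows that the numbers of factors
    agree, and then the injection is a permutation. *)

Set Implicit Arguments.
Unset Strict Implicit.
Unset Printing Implicit Defensive.

(* Otherwise simplification unfolds the adjacency of each concrete product and
   induced subgraph. *)
#[local] Arguments edge {g} _ _ : simpl never.

(** * Graph isomorphisms *)

Definition graph_iso (G H : graph) (f : G -> H) : Prop :=
  bijective f /\ forall v w : G, edge v w <-> edge (f v) (f w).

Lemma graph_iso_inv (G H : graph) (f : G -> H) :
  graph_iso f -> exists g : H -> G, [/\ graph_iso g, cancel f g & cancel g f].
Proof.
case=> -[g fK gK] fE; exists g; split=> //; split; first by exists f.
by move=> v w; rewrite fE !gK.
Qed.

Lemma isomorphic_sym G H : isomorphic G H -> isomorphic H G.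
Proof. by case=> f /graph_iso_inv[g [g_iso _ _]]; exists g. Qed.

Lemma isomorphic_trans G H K :
  isomorphic G H -> isomorphic H K -> isomorphic G K.
Proof.
move=> [f [f_bij fE]] [g [g_bij gE]]; exists (g \o f).
by split=> [|v w]; [apply: bij_comp | rewrite fE gE].
Qed.

Lemma graph_iso_edge (G H : graph) (f : G -> H) v w :
  graph_iso f -> edge (f v) (f w) = edge v w.
Proof. by case=> _ fE; apply/idP/idP => /fE. Qed.

(** Collapsed edges are permitted, since a projection of a product contracts
    the edges of the other factors. *)
Lemma connect_homo (G H : graph) (f : G -> H) :
  (forall v w, edge v w -> f v = f w \/ edge (f v) (f w)) ->
  forall v w, connect (@edge G) v w -> connect (@edge H) (f v) (f w).
Proof.
move=> fE v w /connectP[p + ->]; elim: p v => [|x p IHp] v /=.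
  by rewrite connect0.
case/andP=> /fE[-> /IHp //|vx /IHp]; exact/connect_trans/connect1.
Qed.

Lemma isomorphic_connected G H : isomorphic G H -> connected G -> connected H.
Proof.
case=> f f_iso conG v w; have [g [_ _ gK]] := graph_iso_inv f_iso.
rewrite -[v]gK -[w]gK; apply: connect_homo (conG _ _) => x y xy.
by right; rewrite graph_iso_edge.
Qed.

Lemma unlooped_iso (G H : graph) (f : G -> H) v :
  graph_iso f -> unlooped (f v) = unlooped v.
Proof. by move=> f_iso; rewrite /unlooped graph_iso_edge. Qed.

(** The unlooped vertex rules out the looped one-vertex graph, which counts as
    nontrivial. *)
Lemma nontrivial_neq (G : graph) (v : G) :
  nontrivial G -> unlooped v -> exists w, w != v.
Proof.
move=> ntG v0; have [w wv|v_all] := pickP (fun w => w != v); first by exists w.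
have {}v_all w : w = v by apply/eqP/negPn; rewrite v_all.
case: ntG; split=> [|x y]; last by rewrite (v_all x) (v_all y).
by apply: (@eq_card1 _ v) => w; rewrite (v_all w) !inE eqxx.
Qed.

Lemma isomorphic_irreducible G H :
  isomorphic G H -> irreducible G -> irreducible H.
Proof.
move=> GH [ntG conG [v v0] irrG]; have [f f_iso] := GH.
split; [|exact: isomorphic_connected GH _| |].
- have [w wv] := nontrivial_neq ntG v0; case=> H1 _.
  case/eqP: wv; apply: (bij_inj f_iso.1); apply: fintype_le1P.
  by rewrite H1.
- by exists (f v); rewrite (unlooped_iso v f_iso).
by move=> K L HKL; apply: irrG; apply: isomorphic_trans HKL.
Qed.

(** * Walks and convex sets *)

Fixpoint walk (G : graph) n (x y : G) : bool :=
  if n is m.+1 then [exists z, edge x z && walk m z y] else x == y.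

Lemma walkSP (G : graph) n (x y : G) :
  reflect (exists2 z, edge x z & walk n z y) (walk n.+1 x y).
Proof. exact: exists_inP. Qed.

Lemma walk_cat (G : graph) m n (x y z : G) :
  walk m x y -> walk n y z -> walk (m + n) x z.
Proof.
elim: m x => [|m IHm] x /=; first by move/eqP->.
case/existsP=> t /andP[xt ty] yz; apply/existsP; exists t.
by rewrite xt IHm.
Qed.

Lemma walk_iso (G H : graph) (f : G -> H) n v w :
  graph_iso f -> walk n (f v) (f w) = walk n v w.
Proof.
move=> f_iso; have [g [g_iso fK gK]] := graph_iso_inv f_iso.
elim: n v => [|n IHn] v /=; first by rewrite (can_eq fK).
apply/existsP/existsP => -[z /andP[vz zw]].
  by exists (g z); rewrite -IHn gK zw -(graph_iso_edge _ _ f_iso) gK vz.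
by exists (f z); rewrite graph_iso_edge // vz IHn.
Qed.

Lemma connect_walk (G : graph) (v w : G) :
  connect (@edge G) v w -> exists n, walk n v w.
Proof.
case/connectP=> p + ->; elim: p v => [|x p IHp] v /=; first by exists 0 => /=.
by case/andP=> vx /IHp[n xw]; exists n.+1; apply/existsP; exists x; rewrite vx.
Qed.

(** Shortness of the two walks is expressed by comparing their total length with
    every walk from u to v. This avoids a distance function, which would need
    connectedness to be defined, and makes invariance under isomorphism
    immediate. *)
Definition between (G : graph) (u v w : G) : Prop :=
  exists m n, [/\ walk m u w, walk n w v & forall p, walk p u v -> m + n <= p].

Definition convex (G : graph) (S : {set G}) : Prop :=
  forall u v w, u \in S -> v \in S -> between u v w -> w \in S.

Lemma convex_imset (G H : graph) (f : G -> H) (S : {set G}) :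
  graph_iso f -> convex S -> convex (f @: S).
Proof.
move=> f_iso cvS u' v' w'; have [g [_ _ gK]] := graph_iso_inv f_iso.
case/imsetP=> u uS -> /imsetP[v vS ->]; rewrite -[w']gK.
move: (g w') => w [m [n [uw wv shortest]]]; apply: imset_f.
apply: (cvS u v) => //; exists m, n.
move: uw wv; rewrite !(walk_iso _ _ _ f_iso).
by split=> // p; rewrite -(walk_iso _ _ _ f_iso) => /shortest.
Qed.

(** * Induced subgraphs *)

Section Induced.

Variables (G : graph) (S : {set G}).

Definition induced_edge : rel {x | x \in S} := fun x y => edge (val x) (val y).

Lemma induced_edge_sym : symmetric induced_edge.
Proof. by move=> x y; apply: edge_sym. Qed.

Definition induced : graph := Graph induced_edge_sym.

Lemma induced_inj (x y : induced) : val x = val y -> x = y.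
Proof. exact: val_inj. Qed.

End Induced.

Lemma induced_imset (G H : graph) (f : G -> H) (S : {set G}) :
  graph_iso f -> isomorphic (induced S) (induced (f @: S)).
Proof.
move=> f_iso; have [g [_ fK gK]] := graph_iso_inv f_iso.
have gP (y : induced (f @: S)) : g (val y) \in S.
  by case: y => y /= /imsetP[x xS ->]; rewrite fK.
have fP (x : induced S) : f (val x) \in f @: S by apply/imset_f/valP.
exists (fun x => Sub (f (val x)) (fP x)).
split=> [|v w]; last first.
  by rewrite -[edge v w](graph_iso_edge (val v) (val w) f_iso).
by exists (fun y => Sub (g (val y)) (gP y)) => x; apply: induced_inj;
   rewrite /= ?fK ?gK.
Qed.

(** * Cartesian products over a finite index type *)

Section Product.

Variables (I : finType) (F : I -> graph).

(** Indexing by any finite type, instead of ordinals, allows two families to be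
    juxtaposed over a sum type without transporting vertices along equations
    between graphs. *)
Definition gprod_edge : rel {dffun forall i : I, F i} :=
  fun v w =>
    [exists i, edge (v i) (w i) && [forall j, (j != i) ==> (v j == w j)]].

Lemma gprod_edgeP (v w : {dffun forall i : I, F i}) :
  reflect (exists i, edge (v i) (w i) /\ forall j, j != i -> v j = w j)
          (gprod_edge v w).
Proof.
apply: (iffP existsP) => -[i]; [case/andP=> e vw | case=> e vw]; exists i.
  by split=> // j ji; apply/eqP; move/forallP/(_ j)/implyP: vw; apply.
by rewrite e; apply/forallP=> j; apply/implyP=> /vw->.
Qed.

Lemma gprod_edge_sym : symmetric gprod_edge.
Proof.
by move=> v w; apply/gprod_edgeP/gprod_edgeP => -[i [e vw]]; exists i;
   split=> [|j /vw]; rewrite // edge_sym.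
Qed.

Definition gprod : graph := Graph gprod_edge_sym.

Lemma gprodP (v w : gprod) : (forall i, v i = w i) -> v = w.
Proof. by move=> vw; apply/ffunP. Qed.

Lemma gprod_unlooped (v : gprod) i : unlooped v -> edge (v i) (v i) = false.
Proof.
move=> v0; apply/negP => vi; case/negP: v0; apply/gprod_edgeP.
by exists i.
Qed.

Definition upd (v : gprod) (i : I) (x : F i) : gprod :=
  [ffun j => dfwith v x j].

Lemma upd_at v i (x : F i) : upd v x i = x.
Proof. by rewrite /upd ffunE dfwith_in. Qed.

Lemma upd_off v i (x : F i) j : j != i -> upd v x j = v j.
Proof. by rewrite /upd ffunE eq_sym; apply: dfwith_out. Qed.

Lemma eq_upd (v w : gprod) i (x : F i) :
  (forall j, j != i -> v j = w j) -> upd v x = upd w x.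
Proof.
move=> vw; apply: gprodP => j; have [->|ji] := eqVneq j i.
  by rewrite !upd_at.
by rewrite !upd_off ?vw.
Qed.

Lemma upd_upd v i (x y : F i) : upd (upd v x) y = upd v y.
Proof. by apply: eq_upd => j; apply: upd_off. Qed.

Lemma upd_id (v : gprod) i : upd v (v i) = v.
Proof.
apply: gprodP => j; have [->|ji] := eqVneq j i; first exact: upd_at.
exact: upd_off.
Qed.

Lemma edge_upd v i (x y : F i) : edge x y -> edge (upd v x) (upd v y).
Proof.
move=> xy; apply/gprod_edgeP; exists i; rewrite !upd_at; split=> // j ji.
by rewrite !upd_off.
Qed.

Lemma edge_upd_off (v w : gprod) i (x : F i) c :
  edge (v c) (w c) -> (forall j, j != c -> v j = w j) -> c != i ->
  edge (upd v x) (upd w x).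
Proof.
move=> e vw ci; apply/gprod_edgeP; exists c; rewrite !upd_off //; split=> // j.
by have [->|ji /vw] := eqVneq j i; rewrite ?upd_at ?upd_off.
Qed.

Lemma walk_upd v i n (x y : F i) : walk n x y -> walk n (upd v x) (upd v y).
Proof.
elim: n x => [|n IHn] x /=; first by move/eqP->.
case/existsP=> z /andP[xz zy]; apply/existsP; exists (upd v z).
by rewrite edge_upd // IHn.
Qed.

(** Each step of the walk moves either coordinate i or another coordinate; the
    two kinds of steps are collected separately. The second walk can be placed
    at any height x, because its steps ignore coordinate i. This is the
    additivity of distances in a product, in a form that applies to all
    walks. *)
Lemma walk_split n (u v : gprod) i :
  walk n u v -> exists p q, [/\ p + q = n, walk p (u i) (v i) &
                              forall x : F i, walk q (upd u x) (upd v x)].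
Proof.
elim: n u => [|n IHn] u /=; first by move/eqP->; exists 0, 0 => /=.
case/existsP=> z /andP[/gprod_edgeP[c [uz_c uz]]] /IHn[p [q [<- zv_i zv]]].
have [ci|ci] := eqVneq c i.
  subst c; exists p.+1, q; split=> // [|x].
    by apply/walkSP; exists (z i).
  by rewrite (eq_upd x uz).
exists p, q.+1; split=> [||x]; first by rewrite addnS.
  by rewrite uz // eq_sym.
by apply/walkSP; exists (upd z x); first exact: edge_upd_off uz_c uz ci.
Qed.

(** Split a shortest walk from u to v: changing coordinate i first and the
    others afterwards is a walk of the same length, and it passes through the
    modified vertex. *)
Lemma convex_upd (S : {set gprod}) (u v : gprod) i :
  connected gprod -> convex S -> u \in S -> v \in S -> upd u (v i) \in S.
Proof.
move=> con cvS uS vS; apply: (cvS u v) => //.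
have exn := connect_walk (con u v).
have [n uv shortest] := ex_minnP exn.
have [p [q [pq uv_i uv']]] := walk_split i uv; exists p, q; split.
- by rewrite -{1}[u](upd_id u i); apply: walk_upd.
- by rewrite -{2}[v](upd_id v i).
by rewrite pq.
Qed.

Definition layer (a : gprod) (i : I) : {set gprod} :=
  [set x : gprod | [forall j, (j != i) ==> (x j == a j)]].

Lemma layerP (a x : gprod) i :
  reflect (forall j, j != i -> x j = a j) (x \in layer a i).
Proof.
rewrite inE; apply: (iffP forallP) => xa j.
  by move=> ji; apply/eqP; move/implyP: (xa j); apply.
by apply/implyP=> /xa->.
Qed.

Lemma layer_center a i : a \in layer a i.
Proof. exact/layerP. Qed.

Lemma upd_layer a i (x : F i) : upd a x \in layer a i.
Proof. by apply/layerP=> j ji; rewrite upd_off. Qed.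

Lemma layer_upd a i x : x \in layer a i -> upd a (x i) = x.
Proof. by move/layerP=> xa; rewrite -[RHS](upd_id x i); apply/esym/eq_upd. Qed.

(** If a shortest walk through w left the layer in some coordinate j, deleting
    its steps in coordinate j would leave a shorter walk with the same ends. *)
Lemma convex_layer a i : convex (layer a i).
Proof.
move=> u v w /layerP ua /layerP va [m [n [uw wv shortest]]].
apply/layerP=> j ji.
have [m1 [m2 [Dm uw_j uw']]] := walk_split j uw.
have [n1 [n2 [Dn wv_j wv']]] := walk_split j wv.
have := walk_cat (uw' (a j)) (wv' (a j)).
(* The ends u and v already have coordinate j equal to that of a. *)
rewrite -{1}(ua j ji) -(va j ji) !upd_id => /shortest.
rewrite -Dm -Dn addnACA -[X in _ <= X]add0n leq_add2r leqn0 addn_eq0.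
case/andP=> /eqP m1_0 _; move: uw_j; rewrite m1_0 /= => /eqP <-.
by rewrite ua // va.
Qed.

(** An edge of the layer that lies in a coordinate c other than i would be a
    loop on the c-th coordinate of a, which has none. *)
Lemma induced_layer a i : unlooped a -> isomorphic (induced (layer a i)) (F i).
Proof.
move=> a0; exists (fun x : induced (layer a i) => val x i); split.
  exists (fun x : F i => Sub (upd a x) (upd_layer a x)).
    by case=> x xa; apply: induced_inj; rewrite /= layer_upd.
  by move=> x; rewrite /= upd_at.
case=> [x xa] [y ya] /=; split=> [/gprod_edgeP[c [/= xy_c xy]]|xy].
  have [<- //|ci] := eqVneq c i.
  rewrite (layerP _ _ _ xa) // (layerP _ _ _ ya) // in xy_c.
  by rewrite (gprod_unlooped c a0) in xy_c.
by rewrite /edge /= /induced_edge /= -(layer_upd xa) -(layer_upd ya) edge_upd.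
Qed.

Lemma layer_index_inj a i i' x :
  x \in layer a i -> x != a -> x \in layer a i' -> i = i'.
Proof.
move=> /layerP xi xa /layerP xi'; apply: contraNeq xa => ii'.
apply/eqP/gprodP => j; have [->|/xi //] := eqVneq j i.
exact: xi'.
Qed.

Definition slab (a : gprod) (i : I) : {set gprod} :=
  [set x : gprod | x i == a i].

(** A vertex x of S is encoded by the point of the layer of b with the same i-th
    coordinate and by the point of the slab with the same other coordinates;
    [convex_upd] keeps all these points, and the decoded ones, inside S. *)
Lemma induced_convex_split (S : {set gprod}) b i :
  connected gprod -> convex S -> b \in S -> unlooped b ->
  isomorphic (induced S)
    (cartprod2 (induced (S :&: layer b i)) (induced (S :&: slab b i))).
Proof.
move=> con cvS bS b0.
have hP (x : induced S) : upd b (val x i) \in S :&: layer b i.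
  by rewrite in_setI upd_layer andbT convex_upd //; apply: valP.
have lP (x : induced S) : upd (val x) (b i) \in S :&: slab b i.
  rewrite in_setI [X in _ && X]inE upd_at eqxx andbT convex_upd //; exact: valP.
pose HL := cartprod2 (induced (S :&: layer b i)) (induced (S :&: slab b i)).
have gP (p : HL) : upd (val p.2) (val p.1 i) \in S.
  by case: p => -[h /= /setIP[hS _]] [l /= /setIP[lS _]]; apply: convex_upd.
exists (fun x : induced S => (Sub (upd b (val x i)) (hP x),
                              Sub (upd (val x) (b i)) (lP x))).
split.
  exists (fun p : HL => Sub (upd (val p.2) (val p.1 i)) (gP p)) => [x|].
    by apply: induced_inj; rewrite /= upd_at upd_upd upd_id.
  case=> -[h hH] [l lL]; congr pair; apply: induced_inj => /=.
    by rewrite upd_at layer_upd //; case/setIP: hH.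
  rewrite upd_upd; case/setIP: lL => _; rewrite inE => /eqP <-; exact: upd_id.
case=> [x xS] [y yS]; rewrite {2}/edge /= /cartprod2_edge /=.
rewrite /edge /= /induced_edge /= -!val_eqE /=; split.
  case/gprod_edgeP=> c [xy_c xy]; have [ci|ci] := eqVneq c i.
    by subst c; rewrite (edge_upd b xy_c) (eq_upd _ xy) eqxx.
  by rewrite xy 1?eq_sym // eqxx andbT (edge_upd_off _ xy_c) ?orbT.
(* Conversely, the coordinate c of an edge of the layer must be i, and that of
   an edge of the slab must not be i: otherwise b would have a loop. *)
case/orP=> /andP[/gprod_edgeP[c [xy_c xy]] /eqP Exy]; apply/gprod_edgeP.
  have [ci|ci] := eqVneq c i; last first.
    by rewrite !upd_off // (gprod_unlooped c b0) in xy_c.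
  subst c; rewrite !upd_at in xy_c; exists i; split=> // j ji.
  by rewrite -(upd_off x (b i) ji) Exy upd_off.
have [ci|ci] := eqVneq c i.
  by subst c; rewrite !upd_at (gprod_unlooped i b0) in xy_c.
rewrite !upd_off // in xy_c; exists c; split=> // j jc.
have [->|ji] := eqVneq j i; first by rewrite -(upd_at b (x i)) Exy upd_at.
by rewrite -(upd_off x (b i) ji) xy // upd_off.
Qed.

(** Choose i so that some x in S differs from b at i. The part of S in the layer
    of b is then not a single vertex, so by irreducibility the part in the slab
    is one. Setting the i-th coordinate of any member of S to that of b lands in the
    slab, hence gives b. *)
Lemma irreducible_convex (S : {set gprod}) b :
  connected gprod -> convex S -> b \in S -> unlooped b ->
  irreducible (induced S) -> exists i, S \subset layer b i.
Proof.
move=> con cvS bS b0 [ntS _ _ irrS].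
have [[x xS] /= xb] := nontrivial_neq (v := Sub b bS : induced S) ntS b0.
have [i xb_i] : exists i, x i != b i.
  apply/existsP; apply: contraNT xb => /existsPn xb.
  apply/eqP; apply: (@induced_inj _ S) => /=.
  by apply: gprodP => i; apply/eqP/negPn.
have triv1 (T : {set gprod}) y z :
    trivial (induced T) -> y \in T -> z \in T -> y = z.
  case=> T1 _ yT zT.
  have /(congr1 val) : Sub y yT = Sub z zT :> induced T; last by [].
  by apply: fintype_le1P; rewrite T1.
exists i; case: (irrS _ _ (induced_convex_split i con cvS bS b0)) => triv.
  case/eqP: xb_i; rewrite -(upd_at b (x i)) (triv1 _ (upd b (x i)) b triv) //.
    by rewrite in_setI upd_layer convex_upd.
  by rewrite in_setI layer_center bS.
apply/subsetP=> y yS; apply/layerP=> j ji; rewrite -(upd_off y (b i) ji).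
rewrite (triv1 _ (upd y (b i)) b triv) // in_setI [X in _ && X]inE.
  by rewrite upd_at eqxx convex_upd.
by rewrite bS eqxx.
Qed.

End Product.

(** * Uniqueness of the factors *)

Lemma layer_into_layer (I J : finType) (F : I -> graph) (F' : J -> graph)
    (f : gprod F -> gprod F') (a : gprod F) i :
  graph_iso f -> connected (gprod F') -> unlooped a -> irreducible (F i) ->
  exists j, f @: layer a i \subset layer (f a) j.
Proof.
move=> f_iso con a0 irr; apply: irreducible_convex => //.
- exact/(convex_imset f_iso)/convex_layer.
- exact/imset_f/layer_center.
- by rewrite (unlooped_iso a f_iso).
apply: isomorphic_irreducible irr.
exact: isomorphic_trans (isomorphic_sym (induced_layer i a0))
                        (induced_imset _ f_iso).
Qed.

Lemma layer_sub_inj (I : finType) (F : I -> graph) (a : gprod F) i i' :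
  unlooped a -> irreducible (F i) -> layer a i \subset layer a i' -> i = i'.
Proof.
move=> a0 irr /subsetP sub.
have [ntL _ _ _] :=
  isomorphic_irreducible (isomorphic_sym (induced_layer i a0)) irr.
have [[x xi] /= xa] :=
  nontrivial_neq (v := Sub a (layer_center a i) : induced (layer a i)) ntL a0.
apply: (layer_index_inj xi) (sub x xi); apply: contraNneq xa => xa.
by apply/eqP; apply: (@induced_inj _ (layer a i)).
Qed.

(** The layer of i goes into a layer of some j, which the inverse isomorphism
    sends into a layer of some i'. As layers are not nested, i = i', and both
    inclusions are equalities. *)
Lemma factors_match (I J : finType) (F : I -> graph) (F' : J -> graph) :
  connected (gprod F) -> (exists a : gprod F, unlooped a) ->
  (forall i, irreducible (F i)) -> (forall j, irreducible (F' j)) ->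
  isomorphic (gprod F) (gprod F') ->
  exists pi : I -> J, injective pi /\ forall i, isomorphic (F i) (F' (pi i)).
Proof.
move=> con [a a0] irr irr' iso_FF'.
have con' := isomorphic_connected iso_FF' con.
have [f f_iso] := iso_FF'; have [g [g_iso fK gK]] := graph_iso_inv f_iso.
have b0 : unlooped (f a) by rewrite (unlooped_iso a f_iso).
have image_layer i : exists j, f @: layer a i = layer (f a) j.
  have [j f_sub] := layer_into_layer f_iso con' a0 (irr i).
  have [i' g_sub] := layer_into_layer g_iso con b0 (irr' j).
  rewrite fK in g_sub; exists j; apply/eqP; rewrite eqEsubset f_sub.
  have g_im y : y \in layer (f a) j -> g y \in layer a i'.
    by move=> yj; apply/(subsetP g_sub)/imset_f.
  suff -> : i = i'.
    by apply/subsetP=> y /g_im; rewrite -{2}[y]gK; apply: imset_f.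
  apply: (layer_sub_inj a0 (irr i)); apply/subsetP=> x xi.
  by rewrite -[x]fK; apply/g_im/(subsetP f_sub)/imset_f.
have [pi piE] := fin_all_exists image_layer.
exists pi; split=> [i i' eq_pi|i].
  apply: (layer_sub_inj a0 (irr i)).
  suff -> : layer a i = layer a i' by [].
  by apply: (imset_inj (can_inj fK)); rewrite !piE eq_pi.
apply: isomorphic_trans (isomorphic_sym (induced_layer i a0)) _.
apply: isomorphic_trans (induced_imset _ f_iso) _.
by rewrite piE; apply: induced_layer.
Qed.

(** * Existence of a factorization *)

Lemma cartprod_gprod k (F : 'I_k -> graph) : isomorphic (cartprod F) (gprod F).
Proof. by exists id; split=> //; exists id. Qed.

Lemma gprod_unit (G : graph) : isomorphic G (gprod (fun _ : unit => G)).
Proof.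
exists (fun x => [ffun=> x]); split.
  exists (fun v : gprod (fun _ : unit => G) => v tt) => [x|v].
    by rewrite ffunE.
  by apply: gprodP => -[]; rewrite ffunE.
move=> x y; split=> [xy|/gprod_edgeP[i []]]; last by rewrite !ffunE.
by apply/gprod_edgeP; exists tt; rewrite !ffunE; split=> // -[].
Qed.

Lemma gprod_sum (I J : finType) (F : I -> graph) (F' : J -> graph) :
  isomorphic (cartprod2 (gprod F) (gprod F'))
    (gprod (fun s : I + J =>
              match s with inl i => F i | inr j => F' j end)).
Proof.
set FF' := fun s : I + J => _.
apply: isomorphic_sym; exists (fun v : gprod FF' =>
  ([ffun i => v (inl i)] : gprod F, [ffun j => v (inr j)] : gprod F')).
split.
  exists (fun p : cartprod2 (gprod F) (gprod F') =>
    [ffun s => match s return FF' s with inl i => p.1 i | inr j => p.2 j end]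
      : gprod FF') => [v|[v w]].
    by apply: gprodP => -[i|j]; rewrite !ffunE /= ?ffunE.
  by congr pair; apply: gprodP => i; rewrite !ffunE.
move=> v w; split.
  case/gprod_edgeP=> -[i|j] [e vw]; apply/orP; [left|right]; apply/andP;
    split=> /=.
  - apply/gprod_edgeP; exists i; rewrite !ffunE; split=> // c ci.
    by rewrite !ffunE; apply: (vw (inl c)).
  - by apply/eqP; apply: gprodP => j; rewrite !ffunE; apply: (vw (inr j)).
  - apply/gprod_edgeP; exists j; rewrite !ffunE; split=> // c cj.
    by rewrite !ffunE; apply: (vw (inr c)).
  by apply/eqP; apply: gprodP => i; rewrite !ffunE; apply: (vw (inl i)).
case/orP=> /= /andP[/gprod_edgeP[c [e vw]] /eqP/ffunP Evw]; rewrite !ffunE in e.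
  apply/gprod_edgeP; exists (inl c); split=> // -[i ci|j _].
    by have := vw i ci; rewrite !ffunE.
  by have := Evw j; rewrite !ffunE.
apply/gprod_edgeP; exists (inr c); split=> // -[i _|j jc].
  by have := Evw i; rewrite !ffunE.
by have := vw j jc; rewrite !ffunE.
Qed.

Lemma cartprod2_iso (G G' H H' : graph) :
  isomorphic G G' -> isomorphic H H' ->
  isomorphic (cartprod2 G H) (cartprod2 G' H').
Proof.
move=> [f f_iso] [h h_iso].
have [f' [_ fK f'K]] := graph_iso_inv f_iso.
have [h' [_ hK h'K]] := graph_iso_inv h_iso.
exists (fun p : cartprod2 G H => (f p.1, h p.2) : cartprod2 G' H'); split.
  by exists (fun p => (f' p.1, h' p.2)) => -[x y] /=; rewrite ?fK ?hK ?f'K ?h'K.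
move=> v w; rewrite /edge /= /cartprod2_edge /= (can_eq fK) (can_eq hK).
by rewrite (graph_iso_edge _ _ f_iso) (graph_iso_edge _ _ h_iso).
Qed.

(** Composition with e maps vertices of F to vertices of F o e without any cast;
    the inverse would need one, so bijectivity comes from injectivity and
    equality of cardinals. *)
Lemma gprod_reindex (I J : finType) (F : I -> graph) (e : J -> I) :
  bijective e -> isomorphic (gprod F) (gprod (F \o e)).
Proof.
move=> e_bij; have [e' eK e'K] := e_bij.
exists (fun v : gprod F => [ffun j => v (e j)] : gprod (F \o e)); split.
  apply: inj_card_bij => [v w /ffunP vw|].
    apply: gprodP => i; rewrite -(e'K i).
    by have := vw (e' i); rewrite !ffunE.
  rewrite !card_dep_ffun !foldrE !big_image /= [X in _ <= X](reindex e) //.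
  exact: onW_bij.
move=> v w; split=> /gprod_edgeP[i]; last first.
  rewrite !ffunE => -[vw_i vw]; apply/gprod_edgeP; exists (e i); split=> // j.
  rewrite -(e'K j) (can_eq eK) => ji.
  by have := vw _ ji; rewrite !ffunE.
rewrite -(e'K i) => -[vw_i vw]; apply/gprod_edgeP; exists (e' i).
rewrite !ffunE; split=> // j ji; rewrite !ffunE; apply: vw.
by rewrite (can_eq eK).
Qed.

Lemma cartprod2_factors (H L : graph) :
  connected (cartprod2 H L) -> (exists v : cartprod2 H L, unlooped v) ->
  [/\ connected H, connected L, exists v : H, unlooped v
    & exists v : L, unlooped v].
Proof.
move=> con [[h0 l0]]; rewrite /unlooped /edge /= /cartprod2_edge /= !eqxx.
rewrite !andbT negb_or => /andP[h0_u l0_u]; split;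
  [| |by exists h0|by exists l0].
  move=> x y; pose p1 (v : cartprod2 H L) : H := v.1.
  apply: (connect_homo (f := p1)) (con (x, l0) (y, l0)).
  by move=> v w /orP[] /andP[? /eqP]; [right | left].
move=> x y; pose p2 (v : cartprod2 H L) : L := v.2.
apply: (connect_homo (f := p2)) (con (h0, x) (h0, y)).
by move=> v w /orP[] /andP[? /eqP]; [left | right].
Qed.

Lemma nontrivial_card (G : graph) :
  nontrivial G -> (exists v : G, unlooped v) -> 1 < #|G|.
Proof.
move=> ntG [v v0]; have [w wv] := nontrivial_neq ntG v0.
by apply/card_gt1P; exists w, v.
Qed.

(** Whether a graph splits nontrivially is decided classically: the statement
    quantifies over all pairs of graphs. *)
Lemma irreducible_factorization (G : graph) :
  nontrivial G -> connected G -> (exists v : G, unlooped v) ->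
  exists (I : finType) (F : I -> graph),
    (forall i, irreducible (F i)) /\ isomorphic G (gprod F).
Proof.
have [n] := ubnP #|G|; elim: n G => // n IHn G leGn ntG conG v0.
have [[H [L [GHL [ntH ntL]]]]|no_split] := classic
  (exists H L, isomorphic G (cartprod2 H L) /\ nontrivial H /\ nontrivial L).
  have [conH conL vH vL] : [/\ connected H, connected L,
      exists v : H, unlooped v & exists v : L, unlooped v].
    apply: cartprod2_factors; first exact: isomorphic_connected conG.
    have [f f_iso] := GHL; have [v v_u] := v0.
    by exists (f v); rewrite (unlooped_iso v f_iso).
  have H_gt1 := nontrivial_card ntH vH; have L_gt1 := nontrivial_card ntL vL.
  have cardG : #|G| = #|H| * #|L|.
    by have [f [/bij_eq_card-> _]] := GHL; rewrite card_prod.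
  have [|I [F [irrF isoH]]] := IHn H _ ntH conH vH.
    by rewrite -ltnS (leq_trans _ leGn) // ltnS cardG ltn_Pmulr // ltnW.
  have [|J [F' [irrF' isoL]]] := IHn L _ ntL conL vL.
    by rewrite -ltnS (leq_trans _ leGn) // ltnS cardG ltn_Pmull // ltnW.
  have isoG := isomorphic_trans (isomorphic_trans GHL (cartprod2_iso isoH isoL))
                                (gprod_sum F F').
  by refine (ex_intro _ _ (ex_intro _ _ (conj _ isoG))); case.
exists unit, (fun=> G); split; last exact: gprod_unit.
move=> _; split=> // H L GHL.
have [|ntH] := classic (trivial H); first by left.
by right; apply: NNPP => ntL; apply: no_split; exists H, L.
Qed.

Theorem theorem3p2 (G : graph) (nontrivG : nontrivial G) (connG : connected G)
    (unloopedG : exists v : G, unlooped v) :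
  (exists (k : nat) (F : 'I_k -> graph),
     (forall i, irreducible (F i)) /\ isomorphic G (cartprod F)) /\
  (forall (k l : nat) (F : 'I_k -> graph) (F' : 'I_l -> graph),
     (forall i, irreducible (F i)) -> isomorphic G (cartprod F) ->
     (forall j, irreducible (F' j)) -> isomorphic G (cartprod F') ->
     exists (ekl : k = l) (s : 'S_k),
       forall i : 'I_k, isomorphic (F i) (F' (cast_ord ekl (s i)))).
Proof.
split.
  have [I [F [irrF isoG]]] :=
    irreducible_factorization nontrivG connG unloopedG.
  exists #|I|, (F \o enum_val); split=> [i|]; first exact: irrF.
  apply: isomorphic_trans isoG _.
  apply: isomorphic_trans (isomorphic_sym (cartprod_gprod _)).
  apply: gprod_reindex; exists enum_rank; first exact: enum_valK.
  exact: enum_rankK.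
move=> k l F F' irrF isoF irrF' isoF'.
have {}isoF := isomorphic_trans isoF (cartprod_gprod F).
have {}isoF' := isomorphic_trans isoF' (cartprod_gprod F').
have [v v_u] := unloopedG.
have matching m n (P : 'I_m -> graph) (P' : 'I_n -> graph) :
    (forall i, irreducible (P i)) -> (forall j, irreducible (P' j)) ->
    isomorphic G (gprod P) -> isomorphic G (gprod P') ->
    exists pi : 'I_m -> 'I_n,
      injective pi /\ forall i, isomorphic (P i) (P' (pi i)).
  move=> irrP irrP' isoP isoP'; apply: factors_match => //.
  - exact: isomorphic_connected connG.
  - by have [f f_iso] := isoP; exists (f v); rewrite (unlooped_iso v f_iso).
  exact: isomorphic_trans (isomorphic_sym isoP) isoP'.
have [pi [pi_inj pi_iso]] := matching _ _ _ _ irrF irrF' isoF isoF'.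
have [rho [rho_inj _]] := matching _ _ _ _ irrF' irrF isoF' isoF.
have ekl : k = l.
  apply/eqP; rewrite eqn_leq; move: (leq_card _ pi_inj) (leq_card _ rho_inj).
  by rewrite !card_ord => -> ->.
subst l; exists erefl, (perm pi_inj) => i.
by rewrite permE cast_ord_id.
Qed.
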